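(* Let $k\ge 1$ and $q\ge 0$ be integers, let $\alpha>1$ and $a\in\mathbb{R}$, and let $f:[a,\infty)\to\mathbb{R}$ be a $k$-times continuously differentiable function. Then $$\liminf_{x\to\infty} \frac{x^k \cdot\log x\cdot \log_2 x\cdot\dots\cdot \log_q x \cdot f^{(k)}(x)}{1+|f(x)|^\alpha}\le 0$$ and $$\liminf_{x\to\infty} \frac{x^k\cdot\log x\cdot \log_2 x\cdot\dots\cdot \log_q x \cdot |f^{(k)}(x)|}{1+|f(x)|^\alpha}= 0.$$
   Context: For an integer $p\ge 0$, $\log_p x$ denotes the $p$-times iterated natural logarithm, defined recursively by $\log_0 x:=x$ and $\log_p x:=\log(\log_{p-1} x)$ for $p\ge 1$ (for $x$ large enough that it is defined). The product $\log x\cdot\log_2 x\cdots\log_q x$ is $\prod_{j=1}^q \log_j x$, which is the empty product $1$ when $q=0$; so for $q=0$ the factor in front of $f^{(k)}(x)$ is just $x^k$. The limits inferior are taken in the extended reals $[-\infty,+\infty]$. *)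

(* Defs.v *)
From mathcomp Require Import all_boot all_order all_algebra.
From mathcomp Require Import all_classical all_reals all_analysis.

Set Implicit Arguments.
Unset Strict Implicit.
Unset Printing Implicit Defensive.

Import Order.TTheory GRing.Theory Num.Theory.
Import numFieldNormedType.Exports.

Local Open Scope classical_set_scope.
Local Open Scope ring_scope.

(* [ln] is 0 on nonpositive reals, so [ilog p x] is the p-times iterated
   logarithm of [x] as soon as [x] is large enough. *)
Definition ilog (R : realType) (p : nat) (x : R) : R := iter p (@ln R) x.

Definition diff_quotient (R : realType) (f : R -> R) (x y : R) : R :=
  (f y - f x) / (y - x).

(* A function on a set [A] is represented by a total function of which only the
   values on [A] matter: for [x] in [A], the derivative relative to [A] is the
   limit of the difference quotients at [x] along the points of [A] other than
   [x]. It is the one-sided derivative at an endpoint of an interval, and the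
   usual derivative at an interior point. *)
Definition derivable_within (R : realType) (A : set R) (f : R -> R) (x : R) :=
  cvg (diff_quotient f x y @[y --> within A x^']).

Definition derive_within (R : realType) (A : set R) (f : R -> R) (x : R) : R :=
  lim (diff_quotient f x y @[y --> within A x^']).

Definition deriven_within (R : realType) (A : set R) (n : nat) (f : R -> R) :
  R -> R := iter n (derive_within A) f.

Definition Ck_within (R : realType) (A : set R) (k : nat) (f : R -> R) : Prop :=
  (forall i, (i < k)%N ->
     forall x, A x -> derivable_within A (deriven_within A i f) x) /\
  {within A, continuous (deriven_within A k f)}.

(* Main.v *)
Require Import Defs.
From mathcomp Require Import all_boot all_order all_algebra.
From mathcomp Require Import all_classical all_reals all_analysis.
From mathcomp Require Import ring lra.

Import Order.TTheory GRing.Theory Num.Theory.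
Import numFieldNormedType.Exports.

Local Open Scope classical_set_scope.
Local Open Scope ring_scope.

(** If the first limit inferior were positive, then eventually
    [c * (1 + |f| ^ a) <= x ^ k * L x * f^(k) x] with
    [L = log x * ... * log_q x], and induction on [k] refutes this.
    For [k = 1], [1 / (x * L x)] is the derivative of [log_(q+1)], so [f] tends
    to infinity and [f ^ (1 - a) + (a - 1) * c * log_(q+1)] eventually decreases,
    although it is unbounded above. For [k >= 2], all derivatives have eventually
    constant sign, so [|f|] is monotone. If [f^(k-1) <= 0], the mean value theorem
    on [[x, 2 * x]] yields the same inequality for [- f] at order [k - 1].
    Otherwise all lower derivatives are bounded below by a positive constant,
    [f] grows at least linearly, and it blows up inside [[x0, 2 * x0]] for large
    [x0] because [L x0] is negligible with respect to [x0 ^ (a - 1)].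
    For the second limit inferior, [f^(k)] does not vanish and hence has constant
    sign, so that the above applies to [f] or to [- f]. *)

(** * Iterated logarithms: monotonicity, doubling, derivative and growth of their product *)

Section IteratedLogarithms.
Context {R : realType}.
Implicit Types (x y : R) (j q : nat).

Definition log_prod q x : R := \prod_(1 <= j < q.+1) ilog j x.

(** Where this holds, each [ln] involved is taken at a point [>= 1], away from the nonpositive reals
    where it is [0] by default, and each factor of [log_prod] is at least [1]. *)
Definition ilogs_ge1 q x : Prop := forall j, (j <= q)%N -> 1 <= ilog j x.

Lemma ilogS j x : ilog j.+1 x = ln (ilog j x).
Proof. by []. Qed.

Lemma log_prodS q x : log_prod q.+1 x = log_prod q x * ilog q.+1 x.
Proof. by rewrite /log_prod big_nat_recr. Qed.

Lemma near_ilog_ge j (A : R) : \forall x \near +oo, A <= ilog j x.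
Proof.
elim: j A => [|j IH] A; first exact: nbhs_pinfty_ge (num_real _).
near=> x; rewrite ilogS -[leLHS]expRK.
have h : expR A <= ilog j x by near: x; exact: IH.
by rewrite ler_ln ?posrE ?expR_gt0// (lt_le_trans (expR_gt0 A)).
Unshelve. all: by end_near. Qed.

Lemma near_ilogs_ge1 q : \forall x \near +oo, ilogs_ge1 q x.
Proof.
elim: q => [|q IH].
  by near=> x => -[|//] _; near: x; exact: near_ilog_ge.
near=> x => j; rewrite leq_eqVlt => /predU1P[->|].
  by near: x; exact: near_ilog_ge.
by rewrite ltnS; move: j; near: x.
Unshelve. all: by end_near. Qed.

(** The range reaches [q.+1], one past the hypothesis, because the last [ln] only needs a positive
    argument. *)
Lemma ilog_homo q x y : ilogs_ge1 q x -> x <= y ->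
  forall j, (j <= q.+1)%N -> ilog j x <= ilog j y.
Proof.
move=> hx xy; elim=> [//|j IH] jq; rewrite !ilogS.
have h1 : 1 <= ilog j x by exact: hx.
have h2 : ilog j x <= ilog j y by apply: IH; exact: ltnW.
by rewrite ler_ln ?posrE//; lra.
Qed.

Lemma ilogs_ge1_homo q x y : ilogs_ge1 q x -> x <= y -> ilogs_ge1 q y.
Proof.
by move=> hx xy j jq; rewrite (le_trans (hx j jq))// (ilog_homo _ _ _ hx)// leqW.
Qed.

Lemma ilogs_ge1_gt0 q x : ilogs_ge1 q x -> 0 < x.
Proof. by move=> /(_ 0%N isT); apply: lt_le_trans. Qed.

Lemma log_prod_ge1 q x : ilogs_ge1 q x -> 1 <= log_prod q x.
Proof.
elim: q => [|q IH] h; first by rewrite /log_prod big_geq.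
rewrite log_prodS -[1](mulr1 1); apply: ler_pM => //; last exact: h.
by apply: IH => j jq; apply: h; exact: leqW.
Qed.

Lemma log_prod_homo q x y : ilogs_ge1 q x -> x <= y ->
  log_prod q x <= log_prod q y.
Proof.
move=> h xy; rewrite /log_prod !big_nat; apply: ler_prod => j /andP[_ jq].
have hj : 1 <= ilog j x by exact: h.
by rewrite (ilog_homo _ _ _ h xy _ (ltnW jq)) andbT; lra.
Qed.

(** With [y = ilog j x], [ln (2 * y) = ln 2 + ln y <= 2 * ln y] because [ln 2 <= 1 <= ln y]; so each
    further logarithm keeps the factor 2. *)
Lemma ilog_double q x : ilogs_ge1 q x ->
  forall j, (j <= q)%N -> ilog j (2 * x) <= 2 * ilog j x.
Proof.
move=> h; elim=> [//|j IH] jq; rewrite !ilogS.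
have x_gt0 := ilogs_ge1_gt0 _ _ h.
have h1 : 1 <= ilog j x by apply: h; exact: ltnW.
have h2 : 1 <= ilog j (2 * x).
  by apply: (ilogs_ge1_homo _ _ _ h); [lra|exact: ltnW].
have h3 : 1 <= ln (ilog j x) by exact: h jq.
have : ln (ilog j (2 * x)) <= ln (2 * ilog j x).
  by rewrite ler_ln ?posrE; [exact/IH/ltnW|lra|lra].
rewrite lnM ?posrE; [|lra|lra].
have : ln (1 + 1) <= 1 :> R by apply: le_ln1Dx; lra.
by rewrite -[1 + 1]/(2%:R); lra.
Qed.

Lemma log_prod_double q x : ilogs_ge1 q x ->
  log_prod q (2 * x) <= 2 ^+ q * log_prod q x.
Proof.
move=> h; rewrite /log_prod.
have -> : 2 ^+ q = \prod_(1 <= j < q.+1) (2 : R).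
  by rewrite big_const_nat subn1/= iter_mulr_1.
rewrite -big_split/= !big_nat; apply: ler_prod => j /andP[_ jq].
have h2 : 1 <= ilog j (2 * x).
  apply: (ilogs_ge1_homo _ _ _ h); last by [].
  by have := ilogs_ge1_gt0 _ _ h; lra.
by rewrite (ilog_double _ _ h)// andbT; lra.
Qed.

Lemma is_derive_ilog q x : ilogs_ge1 q x ->
  is_derive x 1 (ilog q.+1) ((x * log_prod q x)^-1).
Proof.
elim: q => [|q IH] h.
  rewrite /log_prod big_geq// mulr1.
  exact/is_derive1_ln/(ilogs_ge1_gt0 _ _ h).
have := IH (fun j jq => h j (leqW jq)) => {}IH.
have h1 : 1 <= ilog q.+1 x by exact: h.
have := @is_derive1_ln R (ilog q.+1 x) (lt_le_trans ltr01 h1) => dl.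
have := is_derive1_comp dl IH.
by rewrite log_prodS mulrA [(_ * ilog _ _)^-1]invfM mulrC.
Qed.

Lemma ilog_le_ln q x : ilogs_ge1 q x ->
  forall j, (j < q)%N -> ilog j.+1 x <= ln x.
Proof.
move=> h; elim=> [//|j IH] jq.
have h1 : 1 <= ilog j.+1 x by apply: h; exact: ltnW.
have := @ln_sublinear R (ilog j.+1 x); rewrite -ilogS => /(_ (lt_le_trans ltr01 h1)).
by have := IH (ltnW jq); lra.
Qed.

(** Each factor is at most [ln x], hence at most x^s / s, and q such factors stay below a multiple
    of x^b because s q <= b. Dividing b by q + 1 rather than q covers q = 0. *)
Lemma log_prod_le_powR q (b : R) : 0 < b ->
  exists2 C : R, 0 < C & forall x, ilogs_ge1 q x -> log_prod q x <= C * x `^ b.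
Proof.
move=> b0; pose s : R := b / q.+1%:R.
have s0 : 0 < s by rewrite divr_gt0.
exists (s^-1 ^+ q); first by rewrite exprn_gt0// invr_gt0.
move=> x h; have x0 := ilogs_ge1_gt0 _ _ h.
have x1 : 1 <= x by exact: (h 0%N).
have lnx : ln x <= s^-1 * x `^ s.
  have := @ln_sublinear R (x `^ s) (powR_gt0 _ x0).
  by rewrite ln_powR => /ltW; rewrite -ler_pdivlMl.
apply: (@le_trans _ _ (ln x ^+ q)).
  have -> : ln x ^+ q = \prod_(1 <= j < q.+1) ln x.
    by rewrite big_const_nat subn1/= iter_mulr_1.
  rewrite /log_prod !big_nat; apply: ler_prod => -[//|j] /andP[_ jq].
  rewrite (ilog_le_ln _ _ h)// andbT.
  by apply: (le_trans ler01); exact: h.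
apply: (@le_trans _ _ ((s^-1 * x `^ s) ^+ q)).
  by rewrite lerXn2r// nnegrE ?ln_ge0// mulr_ge0 ?powR_ge0// invr_ge0 ltW.
rewrite exprMn ler_wpM2l ?exprn_ge0 ?invr_ge0 ?(ltW s0)//.
rewrite -powR_mulrn ?powR_ge0// -powRrM ler_powR//.
by rewrite /s mulrAC ler_pdivrMr// (ler_wpM2l (ltW b0))// ler_nat.
Qed.

End IteratedLogarithms.

(** * Signs and lower bounds passing from a derivative to lower orders *)

Section DerivativesAtInfinity.
Context {R : realType}.
Implicit Types (f df : R -> R) (x y M : R).

Lemma near_pinfty_threshold (P : R -> Prop) :
  (\forall x \near +oo, P x) <-> exists M, forall x, M <= x -> P x.
Proof.
split=> [[M [_ h]]|[M h]].
  by exists (M + 1) => x Mx; apply: h; rewrite (lt_le_trans _ Mx)// ltrDl.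
by near=> x; apply: h; near: x; exact: nbhs_pinfty_ge (num_real _).
Unshelve. all: by end_near. Qed.

Lemma mean_value f df M x y :
  (forall z, M <= z -> is_derive z 1 f (df z)) -> M <= x -> x <= y ->
  exists2 z, x <= z <= y & f y - f x = df z * (y - x).
Proof.
move=> h Mx xy; have [||z] := @MVT_segment R f df x y xy; last first.
- by rewrite in_itv/=; exists z.
- apply: derivable_within_continuous => z; rewrite in_itv/= => /andP[xz _].
  by have [] := h z (le_trans Mx xz).
- by move=> z; rewrite in_itv/= => /andP[xz _]; apply: h; lra.
Qed.

Lemma derive_ge0_homo f df M :
  (forall x, M <= x -> is_derive x 1 f (df x)) ->
  (forall x, M <= x -> 0 <= df x) ->
  forall x y, M <= x -> x <= y -> f x <= f y.
Proof.
move=> h d0 x y Mx xy; have [z /andP[xz zy] e] := mean_value _ _ _ _ _ h Mx xy.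
by rewrite -subr_ge0 e mulr_ge0 ?subr_ge0// d0// (le_trans Mx).
Qed.

Lemma is_deriveN_fun f df x :
  is_derive x 1 f (df x) -> is_derive x 1 (fun y => - f y) (- df x).
Proof. exact: is_deriveN. Qed.

Lemma derive_le0_homo f df M :
  (forall x, M <= x -> is_derive x 1 f (df x)) ->
  (forall x, M <= x -> df x <= 0) ->
  forall x y, M <= x -> x <= y -> f y <= f x.
Proof.
move=> h d0 x y Mx xy; rewrite -lerN2.
apply: (derive_ge0_homo (fun y => - f y) (fun y => - df y) M) => // z Mz.
  exact: is_deriveN_fun (h z Mz).
by rewrite oppr_ge0 d0.
Qed.

Definition sign_from M f : Prop :=
  (forall x, M <= x -> 0 <= f x) \/ (forall x, M <= x -> f x <= 0).

(** A nondecreasing function either reaches a nonnegative value and stays nonnegative from there on,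
    or is negative throughout. *)
Lemma derive_ge0_sign f df M :
  (forall x, M <= x -> is_derive x 1 f (df x)) ->
  (forall x, M <= x -> 0 <= df x) -> exists2 M', M <= M' & sign_from M' f.
Proof.
move=> h d0; have [[x Mx fx0]|H] := pselect (exists2 x, M <= x & 0 <= f x).
  exists x => //; left=> y xy; rewrite (le_trans fx0)//.
  exact: (derive_ge0_homo _ _ _ h d0).
exists M => //; right=> x Mx; rewrite leNgt; apply/negP => fx.
by apply: H; exists x => //; exact: ltW.
Qed.

Lemma derive_sign f df M :
  (forall x, M <= x -> is_derive x 1 f (df x)) ->
  sign_from M df -> exists2 M', M <= M' & sign_from M' f.
Proof.
move=> h [d0|d0]; first exact: (derive_ge0_sign _ _ _ h d0).
have [|//|M' MM' s] :=
  @derive_ge0_sign (fun y => - f y) (fun y => - df y) M.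
- by move=> x Mx; exact: is_deriveN_fun (h x Mx).
- by move=> x Mx; rewrite oppr_ge0 d0.
exists M' => //; case: s => s; [right|left] => x /s; first by rewrite oppr_ge0.
by rewrite oppr_le0.
Qed.

Lemma derive_ge_linear f df d M :
  (forall x, M <= x -> is_derive x 1 f (df x)) ->
  (forall x, M <= x -> d <= df x) ->
  forall x, M <= x -> f M + d * (x - M) <= f x.
Proof.
move=> h hd x Mx; have [z /andP[Mz zx] e] := mean_value _ _ _ _ _ h (lexx M) Mx.
rewrite addrC -lerBrDr e ler_wpM2r ?subr_ge0//; exact: hd.
Qed.

(** The surplus slope [d - e] eventually absorbs any constant. With [e = 0], [A = d] the bound [d]
    passes to [f]; with [e = d / 2], [A = 0] it yields linear growth. *)
Lemma derive_ge_eventually f df d e A M : 0 <= e -> e < d ->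
  (forall x, M <= x -> is_derive x 1 f (df x)) ->
  (forall x, M <= x -> d <= df x) ->
  exists2 M', M <= M' & forall x, M' <= x -> e * x + A <= f x.
Proof.
move=> e0 ed h hd.
exists (Num.max M ((A - f M + d * M) / (d - e))); first by rewrite le_max lexx.
move=> x; rewrite ge_max => /andP[Mx]; rewrite ler_pdivrMr ?subr_gt0// => hx.
by have := derive_ge_linear _ _ _ _ h hd _ Mx; lra.
Qed.

(** [F 0], ..., [F k] stand for f and its derivatives on a half-line; in this form an induction can
    drop the top order or pass to [- F]. *)
Definition derivative_chain k M (F : nat -> R -> R) : Prop :=
  forall i, (i < k)%N -> forall x, M <= x -> is_derive x 1 (F i) (F i.+1 x).

Lemma derivative_chain_sign k M F : derivative_chain k M F ->
  sign_from M (F k) ->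
  exists2 M', M <= M' & forall j, (j <= k)%N -> sign_from M' (F j).
Proof.
elim: k => [|k IH] in M F *.
  by move=> _ s; exists M => // j; rewrite leqn0 => /eqP ->.
move=> h s; have [M1 MM1 s1] := derive_sign _ _ _ (h k (ltnSn k)) s.
have [|M2 MM2 s2] := IH M1 F _ s1.
  by move=> i ik x Mx; apply: (h i (ltnW _)) => //; exact: le_trans Mx.
exists M2 => [|j]; first exact: le_trans MM2.
rewrite leq_eqVlt => /predU1P[->|]; last exact: s2.
by case: s => s; [left|right] => x Mx; apply: s; lra.
Qed.

Lemma derivative_chain_eventually_ge k M F d : 0 < d -> derivative_chain k M F ->
  (forall x, M <= x -> d <= F k x) ->
  exists2 M', M <= M' & forall j, (j <= k)%N -> forall x, M' <= x -> d <= F j x.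
Proof.
move=> d0; elim: k => [|k IH] in M F *.
  by move=> _ s; exists M => // j; rewrite leqn0 => /eqP ->.
move=> h s.
have [M1 MM1 s1] := derive_ge_eventually _ _ d 0 d _ (lexx 0) d0 (h k (ltnSn k)) s.
have [||M2 MM2 s2] := IH M1 F.
- by move=> i ik x Mx; apply: (h i (ltnW _)) => //; exact: le_trans Mx.
- by move=> x Mx; have := s1 x Mx; lra.
exists M2 => [|j]; first exact: le_trans MM2.
rewrite leq_eqVlt => /predU1P[->|]; last exact: s2.
by move=> x Mx; apply: s; lra.
Qed.

(** A crude Taylor bound: each use of the mean value theorem on a step of length [t] lowers the
    order by one and gains a factor [t], the value at the left end of the step being discarded as
    nonnegative. *)
Lemma derivative_chain_growth k M F x t m : derivative_chain k M F ->
  M <= x -> 0 <= t -> 0 <= m ->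
  (forall j, (j <= k)%N -> forall y, M <= y -> 0 <= F j y) ->
  (forall y, x <= y <= x + t *+ k -> m <= F k y) ->
  m * t ^+ k <= F 0%N (x + t *+ k).
Proof.
move=> h Mx t0 m0 F0 Fk.
(* Each descent in order costs one step [t] at the left end of the interval where the bound is
   known. *)
suff H i : (i <= k)%N -> forall y, x + t *+ i <= y <= x + t *+ k ->
    m * t ^+ i <= F (k - i)%N y.
  by have := H k (leqnn k) (x + t *+ k); rewrite lexx subnn; apply.
elim: i => [_ y|i IH ik y /andP[xy yx]].
  by rewrite addr0 expr0 mulr1 subn0; exact: Fk.
have ti : 0 <= t *+ i by exact: mulrn_wge0.
rewrite mulrS in xy.
have ki : (k - i.+1 < k)%N by rewrite subnSK// leq_subr.
have [||z /andP[z1 z2]] := mean_value _ _ M (y - t) y (h _ ki); [lra|lra|].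
rewrite subnSK// opprB (_ : y + (t - y) = t); last lra.
move=> e.
have Fz : m * t ^+ i <= F (k - i)%N z by apply: IH; [exact: ltnW|lra].
have Fyt : 0 <= F (k - i.+1)%N (y - t) by apply: F0; [exact: leq_subr|lra].
by have := ler_wpM2r t0 Fz; rewrite exprSr mulrA -e; lra.
Qed.

End DerivativesAtInfinity.

(** * The differential inequality of order one *)

Section FirstOrder.
Context {R : realType}.
Implicit Types (f g : R -> R) (x y M c : R).

Lemma powR_derivative_exponent x (a : R) : x `^ (1 - a - 1) = (x `^ a)^-1.
Proof. by rewrite -powRN; congr (_ `^ _); ring. Qed.

Lemma first_order_blowup q (a c : R) f g M : 1 < a -> 0 < c ->
  (forall x, M <= x -> is_derive x 1 f (g x)) ->
  (forall x, M <= x -> c * (1 + `|f x| `^ a) <= x * log_prod q x * g x) ->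
  False.
Proof.
move=> a1 c0 df bound.
have [M1 hM1] := (near_pinfty_threshold _).1 (near_ilogs_ge1 (R := R) q).
pose M2 := Num.max M M1.
have big x : M2 <= x -> [/\ M <= x, ilogs_ge1 q x & 0 < x * log_prod q x].
  rewrite ge_max => /andP[Mx /hM1 hx]; split=> //.
  apply: mulr_gt0; first exact: ilogs_ge1_gt0 hx.
  exact: lt_le_trans ltr01 (log_prod_ge1 _ _ hx).
have dl x : M2 <= x -> is_derive x 1 (ilog q.+1) (x * log_prod q x)^-1.
  by move=> /big[_ hx _]; exact: is_derive_ilog.
have bg x : M2 <= x -> c * (1 + `|f x| `^ a) * (x * log_prod q x)^-1 <= g x.
  by move=> /big[Mx _ xL]; rewrite ler_pdivrMr// [g x * _]mulrC bound.
(* Without the term |f|^a the bound still gives f' >= c / (x L x), so f tends to infinity along with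
   [ilog q.+1]. *)
have f_homo x y : M2 <= x -> x <= y ->
    f x - c * ilog q.+1 x <= f y - c * ilog q.+1 y.
  apply: (derive_ge0_homo (fun z => f z - c * ilog q.+1 z)
           (fun z => g z - c * (z * log_prod q z)^-1)) => z Mz.
    have := dl z Mz; have [+ _ _] := big z Mz => /df ? ?.
    exact: is_deriveB.
  have := bg z Mz; have [_ _ zL] := big z Mz.
  have := powR_ge0 `|f z| a; rewrite -invr_gt0 in zL.
  set p := _ `^ a; set w := (_)^-1 in zL *.
  by move=> p0; rewrite subr_ge0; apply: le_trans; rewrite ler_pM2r//; nra.
have [M3 hM3] := (near_pinfty_threshold _).1
  (near_ilog_ge q.+1 ((1 - (f M2 - c * ilog q.+1 M2)) / c)).
pose M4 := Num.max M2 M3.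
have f1 x : M4 <= x -> 1 <= f x.
  rewrite ge_max => /andP[Mx /hM3]; rewrite ler_pdivrMr//.
  by have := f_homo M2 x (lexx _) Mx; lra.
(* Separation of variables in f' >= c f^a / (x L x): the derivative (1 - a) f^(-a) f' + (a - 1) c /
   (x L x) of [G] is nonpositive. *)
pose G x := f x `^ (1 - a) + (a - 1) * c * ilog q.+1 x.
have G_homo x y : M4 <= x -> x <= y -> G y <= G x.
  apply: (derive_le0_homo G (fun z => (1 - a) * f z `^ (1 - a - 1) * g z
           + (a - 1) * c * (z * log_prod q z)^-1)) => z Mz.
    have Mz2 : M2 <= z by move: Mz; rewrite ge_max => /andP[].
    have := dl z Mz2; have [+ _ _] := big z Mz2 => /df ? ?.
    have fz0 : 0 < f z := lt_le_trans ltr01 (f1 z Mz).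
    have := @is_derive1_powR R (1 - a) (f z) fz0 => dp.
    apply: is_deriveD; exact: is_derive1_comp.
  have Mz2 : M2 <= z by move: Mz; rewrite ge_max => /andP[].
  have := bg z Mz2; have [_ _ zL] := big z Mz2.
  have fz := f1 z Mz; rewrite powR_derivative_exponent ger0_norm; last lra.
  have : 0 < f z `^ a by rewrite powR_gt0; lra.
  rewrite -invr_gt0 in zL; set w := (z * _)^-1 in zL *; set p := _ `^ a => p0 gz.
  have : c * w <= p^-1 * g z.
    rewrite -ler_pdivrMl ?invr_gt0// invrK; apply: le_trans gz.
    have : 0 < c * w by exact: mulr_gt0.
    by nra.
  move=> cw; have a10 : 0 <= a - 1 by lra.
  by have := ler_wpM2l a10 cw; lra.
(* Beyond [M5] the logarithmic term of [G] alone exceeds [G M4], while the power of f is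
   nonnegative. *)
have [M5 hM5] := (near_pinfty_threshold _).1
  (near_ilog_ge q.+1 ((G M4 + 1) / ((a - 1) * c))).
have ac : 0 < (a - 1) * c by rewrite mulr_gt0// subr_gt0.
have := hM5 (Num.max M4 M5); rewrite le_max lexx orbT => /(_ isT).
rewrite ler_pdivrMr// mulrC => lo.
have := G_homo M4 (Num.max M4 M5) (lexx _); rewrite le_max lexx => /(_ isT).
have := powR_ge0 (f (Num.max M4 M5)) (1 - a); rewrite {1}/G; lra.
Qed.

End FirstOrder.

(** * Differential inequalities of higher order: blow-up and reduction of the order *)

Section HigherOrder.
Context {R : realType}.
Implicit Types (f : R -> R) (F : nat -> R -> R) (x y M a c : R).

(* [f] doubles on each of the consecutive intervals
   [[x0 * (2 - r ^+ n), x0 * (2 - r ^+ n.+1)]], all contained in [[x0, 2 * x0]]. *)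
Lemma superlinear_blowup (k : nat) (a K r x0 : R) f :
  (0 < k)%N -> 1 < a -> 0 < K -> 0 < x0 -> 0 < f x0 ->
  0 < r < 1 -> 2 `^ (a - 1) * r ^+ k = 1 ->
  (forall x, x0 <= x <= 2 * x0 -> f x <= f (2 * x0)) ->
  (forall x t, x0 <= x -> 0 <= t -> x + t *+ k <= 2 * x0 ->
     f x `^ a * t ^+ k <= K * f (x + t *+ k)) ->
  2 * K <= f x0 `^ (a - 1) * (x0 * (1 - r) / k%:R) ^+ k ->
  False.
Proof.
move=> k0 a1 K0 x00 u0 /andP[r0 r1] rk fmax step init; set u := f x0 in u0 init *.
pose X n := x0 * (2 - r ^+ n).
have rn n : 0 < r ^+ n <= 1.
  by rewrite exprn_gt0//= exprn_ile1// ltW.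
have doubling n : 2 ^+ n * u <= f (X n).
  elim: n => [|n IH]; first by rewrite /X expr0 mul1r (_ : 2 - 1 = 1) ?mulr1//; lra.
  have /andP[rn0 rn1] := rn n.
  (* Chosen so that [k] steps of length [t] lead from [X n] to [X n.+1]. *)
  pose t := x0 * (1 - r) / k%:R * r ^+ n.
  have kR : k%:R != 0 :> R by rewrite pnatr_eq0 -lt0n.
  have tk : t *+ k = x0 * (1 - r) * r ^+ n by rewrite -mulr_natr /t; field.
  have Xt : X n + t *+ k = X n.+1 by rewrite tk /X exprS; ring.
  have Xn : x0 <= X n by rewrite /X ler_peMr ?(ltW x00)//; lra.
  have t0 : 0 <= t by rewrite /t !mulr_ge0 ?invr_ge0 ?(ltW rn0) ?(ltW x00)//; lra.
  have X2 : X n + t *+ k <= 2 * x0.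
    by rewrite Xt /X mulrC ler_pM2r//; have /andP[] := rn n.+1; lra.
  have := step _ _ Xn t0 X2; rewrite Xt => le1.
  have un : 0 < 2 ^+ n * u by rewrite mulr_gt0// exprn_gt0.
  have le2 : (2 ^+ n * u) `^ a <= f (X n) `^ a.
    by rewrite ge0_ler_powR ?nnegrE//; lra.
  have eqa : (2 ^+ n * u) `^ a * t ^+ k =
      2 ^+ n * u * (u `^ (a - 1) * (x0 * (1 - r) / k%:R) ^+ k).
    rewrite -mulr_powRB1 ?(ltW un)//; last lra.
    rewrite powRM ?exprn_ge0 ?(ltW u0)// -powR_mulrn// powRAC powR_mulrn ?powR_ge0//.
    rewrite powR_mulrn// /t exprMn -exprM mulnC exprM.
    (* The relation defining [r] makes the gain 2^(n (a - 1)) cancel the loss r^(k n), so the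
       inequality assumed at [x0] serves for every [n]. *)
    have rkn : (2 `^ (a - 1)) ^+ n * (r ^+ k) ^+ n = 1 by rewrite -exprMn rk expr1n.
    by rewrite -[RHS]mulr1 -[X in _ = _ * X]rkn; ring.
  have le3 : 2 ^+ n * u * (2 * K) <= (2 ^+ n * u) `^ a * t ^+ k.
    by rewrite eqa ler_wpM2l// ltW.
  have le4 := ler_wpM2r (exprn_ge0 k t0) le2.
  rewrite -(ler_pM2l K0); apply: le_trans le1; apply: le_trans le4.
  by apply: le_trans le3; rewrite exprS le_eqVlt; apply/orP; left; apply/eqP; ring.
(* The lower bounds 2^n u are unbounded, yet f is at most [f (2 * x0)] at every [X n]. *)
have [n hn] : exists n : nat, f (2 * x0) / u < n%:R.
  exists (Num.bound `|f (2 * x0) / u|).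
  by apply: le_lt_trans (ler_norm _) (archi_boundP _).
have /andP[rn0 rn1] := rn n.
have : f (X n) <= f (2 * x0) by apply: fmax; rewrite /X; nra.
apply/negP; rewrite -ltNge (lt_le_trans _ (doubling n))//.
rewrite -ltr_pdivrMr// (lt_le_trans hn)// -natrX ler_nat.
exact/ltnW/ltn_expl.
Qed.

(** The constant signs make [|f|] monotone. If it increases, [c1 = 1] works; if it decreases, 1 +
    |f|^a stays between 1 and its value at [M], whose inverse works. *)
Lemma sign_from_quasi_homo f df M a : 0 <= a ->
  (forall x, M <= x -> is_derive x 1 f (df x)) ->
  sign_from M f -> sign_from M df ->
  exists2 c1 : R, 0 < c1 & forall x y, M <= x -> x <= y ->
    c1 * (1 + `|f x| `^ a) <= 1 + `|f y| `^ a.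
Proof.
move=> a0 h sf sdf.
have inc : (forall x y, M <= x -> x <= y -> `|f x| <= `|f y|) \/
           (forall x y, M <= x -> x <= y -> `|f y| <= `|f x|).
  case: sf => sf; case: sdf => sdf.
  - left=> x y Mx xy; rewrite !ger0_norm ?sf//; last lra.
    exact: (derive_ge0_homo _ _ _ h sdf).
  - right=> x y Mx xy; rewrite !ger0_norm ?sf//; last lra.
    exact: (derive_le0_homo _ _ _ h sdf).
  - right=> x y Mx xy; rewrite !ler0_norm ?sf//; last lra.
    by rewrite lerN2; exact: (derive_ge0_homo _ _ _ h sdf).
  - left=> x y Mx xy; rewrite !ler0_norm ?sf//; last lra.
    by rewrite lerN2; exact: (derive_le0_homo _ _ _ h sdf).
have pow u v : `|u| <= `|v| -> `|u : R| `^ a <= `|v : R| `^ a.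
  by move=> uv; rewrite ge0_ler_powR.
case: inc => inc.
  by exists 1 => // x y Mx xy; rewrite mul1r lerD2l pow// inc.
have p0 : 0 < 1 + `|f M| `^ a by have := powR_ge0 `|f M| a; lra.
exists (1 + `|f M| `^ a)^-1; first by rewrite invr_gt0.
move=> x y Mx xy; apply: (@le_trans _ _ 1).
  by rewrite ler_pdivrMl// mulr1 lerD2l pow// inc.
by rewrite lerDl powR_ge0.
Qed.

Lemma powR_large (b A : R) : 0 < b ->
  exists M, forall x, M <= x -> A <= x `^ b.
Proof.
move=> b0; exists (`|A| `^ b^-1) => x hx.
apply: (le_trans (ler_norm A)).
rewrite -[leLHS]powRr1// -(mulVf (lt0r_neq0 b0)) powRrM.
by rewrite ge0_ler_powR ?nnegrE ?powR_ge0 ?(ltW b0)// (le_trans (powR_ge0 _ _) hx).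
Qed.

Lemma increasing_derivative_blowup k q a c F M : 1 < a -> 0 < c ->
  derivative_chain k.+2 M F ->
  (forall x, M <= x -> ilogs_ge1 q x) ->
  (forall x, M <= x ->
     c * (1 + `|F 0%N x| `^ a) <= x ^+ k.+2 * log_prod q x * F k.+2 x) ->
  (forall x, M <= x -> 0 <= F k.+2 x) ->
  forall x, M <= x -> F k.+1 x <= 0.
Proof.
move=> a1 c0 h hlog bound Fk_ge0 x1 Mx1; rewrite leNgt; apply/negP => d0.
set d := F k.+1 x1 in d0.
have h1 : derivative_chain k.+1 x1 F.
  by move=> i ik x x1x; apply: h; [exact: ltnW|lra].
have [|M3 x1M3 hM3] := derivative_chain_eventually_ge _ _ _ _ d0 h1.
  by move=> x; exact: (derive_ge0_homo _ _ _ (h k.+1 (ltnSn _))).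
have [|||M4 M34 hM4] := derive_ge_eventually (F 0%N) (F 1%N) d (d / 2) 0 M3 _ _
  _ (hM3 1%N isT); [lra|lra| |].
  by move=> x Mx; apply: h1 => //; lra.
pose K0 : R := k.+2%:R.
have K00 : 0 < K0 by rewrite ltr0n.
(* The solution of 2^(a - 1) r^(k + 2) = 1; it is below 1 because a > 1. *)
pose r : R := 2 `^ (- ((a - 1) / K0)).
have s0 : 0 < (a - 1) / K0 by apply: divr_gt0 => //; lra.
have r0 : 0 < r by rewrite powR_gt0.
have rk : 2 `^ (a - 1) * r ^+ k.+2 = 1.
  rewrite -powR_mulrn ?(ltW r0)// /r -powRrM mulNr divfK ?gt_eqF//.
  by rewrite powRN mulfV// gt_eqF// powR_gt0.
have r1 : r < 1.
  rewrite /r powRN invf_lt1 ?powR_gt0//.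
  by rewrite /powR [2 == 0]gt_eqF//= expR_gt1 mulr_gt0// ln_gt0//; lra.
(* Linear growth makes f(x0)^(a - 1) at least [D] x0^(2 b): one factor x0^b dominates
   [log_prod q (2 * x0)], the other outgrows the constants. *)
pose b := (a - 1) / 2.
have b0 : 0 < b by rewrite /b; lra.
have [C C0 hC] := log_prod_le_powR (R := R) q b b0.
pose D := (d / 2) `^ (a - 1).
have D0 : 0 < D by rewrite powR_gt0; lra.
pose E := ((1 - r) / K0) ^+ k.+2.
have E0 : 0 < E by rewrite exprn_gt0// divr_gt0//; lra.
(* The requirement 2 K <= f(x0)^(a - 1) x0^(k + 2) E, once x0^(k + 2) x0^b is cancelled from both
   sides. *)
have [M5 hM5] := powR_large b (2 * (2 ^+ k.+2 * (C * 2 `^ b)) / (c * D * E)) b0.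
pose x0 := Num.max M4 M5.
have M4x0 : M4 <= x0 by rewrite le_max lexx.
have M5x0 : M5 <= x0 by rewrite le_max lexx orbT.
have Mx0 : M <= x0 by lra.
have x00 : 0 < x0 by exact: ilogs_ge1_gt0 (hlog _ Mx0).
have lo := hM4 _ M4x0; rewrite addr0 in lo.
have dx0 : 0 < d / 2 * x0 by rewrite mulr_gt0//; lra.
have F0_gt0 : 0 < F 0%N x0 by exact: lt_le_trans lo.
have L0 : 0 < (2 * x0) ^+ k.+2 * log_prod q (2 * x0).
  apply: mulr_gt0; first by rewrite exprn_gt0// mulr_gt0.
  by apply: lt_le_trans ltr01 (log_prod_ge1 _ _ (hlog _ _)); lra.
have F_ge0 j : (j <= k.+2)%N -> forall y, M3 <= y -> 0 <= F j y.
  rewrite leq_eqVlt => /predU1P[-> y My|jk y My]; first by apply: Fk_ge0; lra.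
  by have := hM3 j jk y My; lra.
have F0_homo x y : M3 <= x -> x <= y -> F 0%N x <= F 0%N y.
  move=> Mx xy; apply: (derive_ge0_homo _ (F 1%N) M3) => // z Mz.
    by apply: h => //; lra.
  exact: F_ge0.
(* [K] is the weight at [2 * x0], an upper bound for it on [[x0, 2 * x0]], divided by [c]. *)
apply: (superlinear_blowup k.+2 a ((2 * x0) ^+ k.+2 * log_prod q (2 * x0) / c)
         r x0 (F 0%N)) => //.
- by rewrite divr_gt0.
- by rewrite r0.
- by move=> x /andP[x0x xx0]; apply: F0_homo => //; lra.
- move=> x t x0x t0 xt.
  have Fx0 : 0 < F 0%N x by apply: lt_le_trans F0_gt0 _; apply: F0_homo => //; lra.
  (* As f is nondecreasing, [F k.+2] is at least f(x)^a / K from [x] to [x + t *+ k.+2], and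
     [derivative_chain_growth] brings this down to order 0. *)
  rewrite -ler_pdivrMl ?divr_gt0// mulrA.
  apply: (derivative_chain_growth _ M3) => //; [|lra| |].
  + by move=> i ik y My; apply: h => //; lra.
  + by rewrite mulr_ge0 ?powR_ge0// invr_ge0 divr_ge0 ?ltW.
  move=> y /andP[xy yxt]; rewrite ler_pdivrMl ?divr_gt0// mulrAC ler_pdivlMr//.
  have My : M <= y by lra.
  have Fy : F 0%N x `^ a <= `|F 0%N y| `^ a.
    rewrite ge0_ler_powR ?nnegrE//; [lra|lra|].
    by apply: le_trans (ler_norm _); apply: F0_homo => //; lra.
  apply: (@le_trans _ _ (c * (1 + `|F 0%N y| `^ a))).
    by rewrite mulrC ler_pM2l//; lra.
  apply: (le_trans (bound y My)); rewrite ler_wpM2r ?Fk_ge0//.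
  have y0 : 0 < y by lra.
  apply: ler_pM; first by rewrite exprn_ge0// ltW.
  + by apply: le_trans ler01 (log_prod_ge1 _ _ (hlog _ My)).
  + by rewrite lerXn2r ?nnegrE//; lra.
  + by apply: log_prod_homo; [exact: hlog|lra].
- have e1 : D * x0 `^ b * x0 `^ b <= F 0%N x0 `^ (a - 1).
    apply: (@le_trans _ _ ((d / 2 * x0) `^ (a - 1))).
      rewrite powRM; [|lra|lra].
      rewrite -/D -mulrA -powRD; last by rewrite (gt_eqF x00) implybT.
      by rewrite (_ : b + b = a - 1)// /b; lra.
    by rewrite ge0_ler_powR ?nnegrE//; lra.
  have e2 : log_prod q (2 * x0) <= C * 2 `^ b * x0 `^ b.
    by rewrite -mulrA -powRM ?(ltW x00)// hC//; apply: hlog; lra.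
  have -> : (x0 * (1 - r) / k.+2%:R) ^+ k.+2 = x0 ^+ k.+2 * E.
    by rewrite -mulrA exprMn.
  rewrite mulrA ler_pdivrMr//.
  have cDE := mulr_gt0 (mulr_gt0 c0 D0) E0.
  have xb := hM5 _ M5x0; rewrite (ler_pdivrMr _ _ cDE) in xb.
  have xb0 : 0 < x0 `^ b by rewrite powR_gt0.
  have xk0 : 0 < x0 ^+ k.+2 by rewrite exprn_gt0.
  apply: (@le_trans _ _ (D * x0 `^ b * x0 `^ b * (x0 ^+ k.+2 * E) * c)); last first.
    by rewrite ler_pM2r// ler_pM2r// mulr_gt0.
  apply: (@le_trans _ _ (2 * ((2 * x0) ^+ k.+2 * (C * 2 `^ b * x0 `^ b)))).
    by rewrite ler_pM2l// ler_pM2l// exprn_gt0// mulr_gt0.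
  rewrite exprMn; have := ler_wpM2r (ltW (mulr_gt0 xb0 xk0)) xb; lra.
Qed.

(** Since [F k.+1 (2 * x) <= 0], the mean value theorem on [[x, 2 * x]] gives
    [F k.+2 z * x <= - F k.+1 x]. Moving the bound from [z] to [x] costs the factor [c1] of
    quasi-monotonicity on the left and 2^(k + 2) 2^q for the weight on the right. *)
Lemma order_reduction k q a c F M : 0 <= a -> 0 < c ->
  derivative_chain k.+2 M F ->
  (forall x, M <= x -> ilogs_ge1 q x) ->
  (forall x, M <= x ->
     c * (1 + `|F 0%N x| `^ a) <= x ^+ k.+2 * log_prod q x * F k.+2 x) ->
  sign_from M (F 0%N) -> sign_from M (F 1%N) ->
  (forall x, M <= x -> F k.+1 x <= 0) ->
  exists2 c' : R, 0 < c' & forall x, M <= x ->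
    c' * (1 + `|F 0%N x| `^ a) <= x ^+ k.+1 * log_prod q x * (- F k.+1 x).
Proof.
move=> a0 c0 h hlog bound s0 s1 Fk.
have [c1 c10 hc1] := sign_from_quasi_homo _ _ _ _ a0 (h 0%N isT) s0 s1.
have p0 : 0 < 2 ^+ k.+2 * 2 ^+ q :> R by rewrite -exprD exprn_gt0.
exists (c * c1 / (2 ^+ k.+2 * 2 ^+ q)); first by rewrite divr_gt0// mulr_gt0.
move=> x Mx; have x0 := ilogs_ge1_gt0 _ _ (hlog x Mx).
have x2 : x <= 2 * x by lra.
have [z /andP[xz z2x]] := mean_value _ _ _ _ _ (h k.+1 (ltnSn _)) Mx x2.
rewrite (_ : 2 * x - x = x); last lra.
move=> e; have Fz : F k.+2 z * x <= - F k.+1 x.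
  by rewrite -e; have := Fk (2 * x); lra.
have Mz : M <= z by lra.
have L1 := log_prod_ge1 _ _ (hlog x Mx).
rewrite mulrAC ler_pdivrMr//.
apply: (@le_trans _ _ (c * (1 + `|F 0%N z| `^ a))).
  by rewrite -mulrA ler_pM2l// hc1.
have zL : 0 < z ^+ k.+2 * log_prod q z.
  apply: mulr_gt0; first by rewrite exprn_gt0//; lra.
  exact: lt_le_trans ltr01 (log_prod_ge1 _ _ (hlog _ Mz)).
have Fz0 : 0 <= F k.+2 z.
  rewrite -(pmulr_rge0 _ zL); apply: le_trans (bound z Mz).
  by rewrite mulr_ge0 ?(ltW c0)// addr_ge0// powR_ge0.
apply: (le_trans (bound z Mz)).
apply: (@le_trans _ _ ((2 * x) ^+ k.+2 * (2 ^+ q * log_prod q x) * F k.+2 z)).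
  rewrite ler_wpM2r//; apply: ler_pM.
  - by rewrite exprn_ge0//; lra.
  - by apply: le_trans ler01 (log_prod_ge1 _ _ (hlog _ Mz)).
  - by rewrite lerXn2r ?nnegrE//; lra.
  - apply: le_trans (log_prod_double _ _ (hlog x Mx)).
    by apply: log_prod_homo z2x; exact: hlog.
rewrite exprMn [x ^+ k.+2]exprSr.
have P0 : 0 <= 2 ^+ k.+2 * 2 ^+ q * (x ^+ k.+1 * log_prod q x).
  by rewrite mulr_ge0 ?(ltW p0)// mulr_ge0 ?exprn_ge0//; lra.
by have := ler_wpM2l P0 Fz; lra.
Qed.

Lemma higher_order_blowup k q a c F M : (0 < k)%N -> 1 < a -> 0 < c ->
  derivative_chain k M F ->
  (forall x, M <= x ->
     c * (1 + `|F 0%N x| `^ a) <= x ^+ k * log_prod q x * F k x) ->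
  False.
Proof.
elim: k c F M => [//|[|k] IH] c F M _ a1 c0 h bound.
  by apply: (first_order_blowup q a c (F 0%N) (F 1%N) M) => //; exact: (h 0%N).
have [M1 hM1] := (near_pinfty_threshold _).1 (near_ilogs_ge1 (R := R) q).
pose M2 := Num.max M M1.
have big x : M2 <= x -> M <= x /\ ilogs_ge1 q x.
  by rewrite ge_max => /andP[Mx /hM1 hx].
have h2 : derivative_chain k.+2 M2 F.
  by move=> i ik x /big[Mx _]; exact: h.
have Fk_ge0 x : M2 <= x -> 0 <= F k.+2 x.
  move=> /big[Mx hx].
  have xL : 0 < x ^+ k.+2 * log_prod q x.
    apply: mulr_gt0; first by rewrite exprn_gt0// (ilogs_ge1_gt0 q).
    exact: lt_le_trans ltr01 (log_prod_ge1 _ _ hx).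
  rewrite -(pmulr_rge0 _ xL); apply: le_trans (bound x Mx).
  by rewrite mulr_ge0 ?(ltW c0)// addr_ge0// powR_ge0.
have [|M3 M23 sF] := derivative_chain_sign _ _ _ h2; first by left.
have h3 : derivative_chain k.+2 M3 F.
  by move=> i ik x Mx; apply: h2 => //; lra.
have big3 x : M3 <= x -> M <= x /\ ilogs_ge1 q x by move=> Mx; apply: big; lra.
have [||||||||c' c'0 bound'] := order_reduction k q a c F M3.
- lra.
- by [].
- by [].
- by move=> x /big3[].
- by move=> x /big3[+ _]; exact: bound.
- exact: sF.
- exact: sF.
- apply: (increasing_derivative_blowup k q a c) => // x Mx.
  + by have [] := big3 x Mx.
  + by apply: bound; have [] := big3 x Mx.
  + by apply: Fk_ge0; lra.
(* The left side depends on [|F 0|] only, so [- F] without its top order satisfies the hypotheses at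
   order [k.+1]. *)
apply: (IH c' (fun i x => - F i x) M3) => //.
  by move=> i ik x Mx; apply: is_deriveN_fun; apply: h3 => //; exact: leqW.
by move=> x Mx; rewrite normrN; exact: bound'.
Qed.

End HigherOrder.

(** * Relative derivatives at interior points *)

Section DerivativesWithin.
Context {R : realType}.
Implicit Types (f : R -> R) (A : set R) (x : R).

(** Points close to an interior point [x] lie in [A], so the translation [h + x] turns the relative
    limit into the usual one at 0. *)
Lemma is_derive_within A f x : nbhs x A -> derivable_within A f x ->
  is_derive x 1 f (derive_within A f x).
Proof.
move=> Ax df; set l := derive_within A f x.
have shiftA : h + x @[h --> (0 : R)^'] --> within A x^'.
  move=> P /= hP; rewrite /nbhs/= /dnbhs /within/=.
  have : \forall y \near x, y != x -> P y.
    by apply: filterS2 Ax hP => y Ay h yx; exact: h.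
  rewrite (near_shift 0) subr0; apply: filterS => h hP' h0.
  by apply: hP'; rewrite /= -subr_eq0 addrK.
have : (diff_quotient f x \o (fun h => h + x)) h @[h --> (0 : R)^'] --> l.
  exact: cvg_comp shiftA df.
have -> : diff_quotient f x \o (fun h => h + x) =
    (fun h => h^-1 *: ((f \o shift x) (h *: 1) - f x)).
  apply/funext => h; rewrite /diff_quotient /= addrK mulrC.
  by congr (_ * (f (_ + _) - _)); rewrite -[RHS]/(h * 1) mulr1.
move=> cl; apply: DeriveDef; first by apply/cvg_ex; exists l.
exact: cvg_lim cl.
Qed.

End DerivativesWithin.

(** * Limits inferior in the extended reals as eventual bounds *)

Section LimInf.
Context {R : realType} {T : choiceType} {X : filteredType T}.
Implicit Types (F : set_system X) (g : X -> R).

(** The limit inferior is the supremum, over the sets of the filter, of the infima of [g]; if it is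
    positive, one of these infima is. *)
Lemma limf_einf_gt0 F g : Filter F ->
  (0 < limf_einf (fun x => (g x)%:E) F)%E ->
  exists2 c : R, 0 < c & \forall x \near F, c <= g x.
Proof.
move=> FF; rewrite limf_einfE => /ereal_sup_gt[_ [A FA <-] A0].
have lb x : A x -> (ereal_inf ((fun x => (g x)%:E) @` A) <= (g x)%:E)%E.
  by move=> Ax; apply: ereal_inf_lbound; exists x.
case: (ereal_inf _) A0 lb => [c| |] //.
  rewrite lte_fin => c0 lb; exists c => //.
  by apply: filterS FA => x /lb; rewrite lee_fin.
(* An infimum [+oo] of real values means that [A] is empty, so any positive constant serves. *)
by move=> _ lb; exists 1 => //; apply: filterS FA => x /lb.
Qed.

Lemma limf_einf_ge0 F g : Filter F -> (\forall x \near F, 0 <= g x) ->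
  (0 <= limf_einf (fun x => (g x)%:E) F)%E.
Proof.
move=> FF g0; rewrite limf_einfE; apply: ereal_sup_ge.
exists (ereal_inf ((fun x => (g x)%:E) @` [set x | 0 <= g x])).
  by exists [set x | 0 <= g x].
by apply: le_ereal_inf_tmp => _ [x gx <-]; rewrite lee_fin.
Qed.

End LimInf.

(** By the intermediate value theorem, values of opposite signs at [M] and at [x] would enclose a
    zero. *)
Lemma continuous_nonzero_sign {R : realType} (f : R -> R) (M : R) :
  {within `[M, +oo[, continuous f} -> (forall x, M <= x -> f x != 0) ->
  (forall x, M <= x -> 0 < f x) \/ (forall x, M <= x -> f x < 0).
Proof.
move=> cf nz.
have same_sign x : M <= x -> 0 < f M * f x.
  move=> Mx; rewrite lt_neqAle eq_sym mulf_neq0 ?nz//=.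
  rewrite leNgt; apply/negP => neg.
  have [||z] := @IVT R f M x 0 Mx.
  - apply: continuous_subspaceW cf => z; rewrite /= !in_itv/=.
    by move=> /andP[->].
  - rewrite ge_min le_max.
    by case: (ltgtP (f M) 0) neg => // fM; case: (ltgtP (f x) 0) => // fx; nra.
  - by rewrite in_itv/= => /andP[Mz _] fz; have := nz z Mz; rewrite fz eqxx.
have := nz M (lexx M); rewrite neq_lt => /orP[] fM; [right|left] => x Mx.
  by have := same_sign x Mx; rewrite nmulr_rgt0.
by have := same_sign x Mx; rewrite pmulr_rgt0.
Qed.


(** * Both limits inferior, from the impossibility of the inequality of order [k] *)

Theorem theorem1 (R : realType) (k q : nat) (alpha a : R) (f : R -> R)
    (k_ge1 : (1 <= k)%N) (alpha_gt1 : 1 < alpha)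
    (f_Ck : Ck_within `[a, +oo[ k f) :
  (limf_einf
     (fun x : R =>
        ((x ^+ k * (\prod_(1 <= j < q.+1) ilog j x)
            * deriven_within `[a, +oo[ k f x)
         / (1 + `|f x| `^ alpha))%:E)
     (pinfty_nbhs R) <= 0)%E /\
  limf_einf
     (fun x : R =>
        ((x ^+ k * (\prod_(1 <= j < q.+1) ilog j x)
            * `|deriven_within `[a, +oo[ k f x|)
         / (1 + `|f x| `^ alpha))%:E)
     (pinfty_nbhs R) = 0%E.
Proof.
set F := fun i => deriven_within `[a, +oo[ i f.
have [df cf] := f_Ck.
(* Starting at [a + 1] avoids the endpoint [a], where the relative derivative is one-sided. *)
have nbhs_dom x : a + 1 <= x -> nbhs x (`[a, +oo[)%classic.
  move=> ax; apply: (@filterS _ _ _ (`]a, +oo[)%classic).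
    by move=> y /=; rewrite !in_itv/= !andbT => /ltW.
  by apply: open_nbhs_nbhs; split; [exact: interval_open|rewrite /= in_itv/=; lra].
have chain M : a + 1 <= M -> derivative_chain k M F.
  move=> aM i ik x Mx; apply: is_derive_within; first by apply: nbhs_dom; lra.
  by apply: df => //; rewrite /= in_itv/=; lra.
have pos x : 0 < 1 + `|f x| `^ alpha by have := powR_ge0 `|f x| alpha; lra.
(* Stated for any [G] so as to serve both f^(k) and its absolute value. *)
have threshold (G : R -> R) : (0 < limf_einf (fun x : R =>
      (x ^+ k * (\prod_(1 <= j < q.+1) ilog j x) * G x /
         (1 + `|f x| `^ alpha))%:E) (pinfty_nbhs R))%E ->
    exists c M, [/\ 0 < c, a + 1 <= M & forall x, M <= x -> ilogs_ge1 q x /\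
      c * (1 + `|f x| `^ alpha) <= x ^+ k * log_prod q x * G x].
  move=> /limf_einf_gt0[c c0 hc].
  have [M1 hM1] := (near_pinfty_threshold _).1 hc.
  have [M2 hM2] := (near_pinfty_threshold _).1 (near_ilogs_ge1 (R := R) q).
  exists c, (Num.max (a + 1) (Num.max M1 M2)); split=> //.
    by rewrite le_max lexx.
  by move=> x; rewrite !ge_max => /and3P[_ /hM1 + /hM2]; rewrite ler_pdivlMr.
split.
  rewrite leNgt; apply/negP => /threshold[c [M [c0 aM hM]]].
  apply: (higher_order_blowup k q alpha c F M) => //; first exact: chain.
  by move=> x /hM[].
apply/eqP; rewrite eq_le; apply/andP; split; last first.
  apply: limf_einf_ge0; near=> x.
  have hx : ilogs_ge1 q x by near: x; exact: near_ilogs_ge1.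
  rewrite divr_ge0 ?(ltW (pos x))// !mulr_ge0//.
    by rewrite exprn_ge0// ltW// (ilogs_ge1_gt0 q).
  exact: le_trans ler01 (log_prod_ge1 _ _ hx).
rewrite leNgt; apply/negP => /threshold[c [M [c0 aM hM]]].
(* At a zero of f^(k) the right side of the bound would vanish while the left side is positive. *)
have Fk_neq0 x : M <= x -> F k x != 0.
  move=> /hM[_ hx]; apply/negP => /eqP Fkx; move: hx.
  rewrite -/(F k x) Fkx normr0 mulr0 leNgt => /negP; apply.
  by rewrite mulr_gt0.
have cM : {within `[M, +oo[, continuous (F k)}.
  apply: continuous_subspaceW cf => z; rewrite /= !in_itv/= !andbT; lra.
have [Fk|Fk] := continuous_nonzero_sign _ _ cM Fk_neq0.
  apply: (higher_order_blowup k q alpha c F M) => //; first exact: chain.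
  by move=> x Mx; have [_] := hM x Mx; rewrite (gtr0_norm (Fk x Mx)).
apply: (higher_order_blowup k q alpha c (fun i x => - F i x) M) => //.
  by move=> i ik x Mx; apply: is_deriveN_fun; exact: chain Mx.
by move=> x Mx; have [_] := hM x Mx; rewrite (ltr0_norm (Fk x Mx)) normrN.
Unshelve. all: by end_near. Qed.
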